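(* For Minimum Spanning Forest in the Late Accept/Reject model, the competitive ratio is $1$; that is, there is a strictly $1$-competitive online algorithm in this model (so $\mathrm{ALG}(\sigma)=\mathrm{OPT}(\sigma)$ for every input $\sigma$), and for every real $c<1$ no online algorithm in this model is $c$-competitive.
   Context: Online Minimum Spanning Forest (edge arrival). An input $\sigma$ is a finite simple undirected graph $G=(V,E)$ with a weight function $w\colon E\to\mathbb{R}^+$ and an ordering of its edges. Edges arrive one by one in this order with their weights; endpoints not seen before are revealed with the edge. All online algorithms are deterministic: each decision depends only on the part of the input revealed so far. After each arrival has been processed, the set of currently accepted edges must be a spanning forest of the graph revealed so far, i.e., it must form a spanning tree on each connected component of that graph. $\mathrm{ALG}(\sigma)$ is the total weight of the accepted edges at the end of the input, and $\mathrm{OPT}(\sigma)$ is the minimum total weight of a spanning forest of $G$; the objective is minimization. Late Accept/Reject model: in each step the algorithm may accept the newly arrived edge and any earlier edges that have not been late-rejected, and it may remove (late-reject) accepted edges; a late-rejected edge can never be accepted again. An algorithm $\mathrm{ALG}$ is $c$-competitive if there is a constant $\alpha$ such that $\mathrm{ALG}(\sigma)\le c\,\mathrm{OPT}(\sigma)+\alpha$ for all inputs $\sigma$; it is strictly $c$-competitive if this holds with $\alpha=0$. By convention, ''the competitive ratio is $c$'' includes that the upper bound holds for the strict competitive ratio and the lower bound for the (non-strict) competitive ratio. *)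

(* Defs.v *)
From mathcomp Require Import all_boot all_order all_algebra finmap.
From mathcomp Require Import boolp classical_sets reals.

Set Implicit Arguments.
Unset Strict Implicit.
Unset Printing Implicit Defensive.

Import Order.TTheory GRing.Theory Num.Theory.
Local Open Scope fset_scope.
Local Open Scope ring_scope.

(** Vertices are named by natural numbers; an undirected edge is the set of
    its two endpoints. *)

Definition simple_graph (V : {fset nat}) (E : {fset {fset nat}}) : Prop :=
  forall e, e \in E -> #|` e| = 2%N /\ e `<=` V.

(** Irreflexive when all edges have two endpoints, since
    [[fset x; x]] is a singleton. *)
Definition adj (F : {fset {fset nat}}) : rel nat :=
  fun x y => [fset x; y] \in F.

Definition linked (F : {fset {fset nat}}) (x y : nat) : Prop :=
  exists2 p : seq nat, path (adj F) x p & last x p = y.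

Definition acyclic (F : {fset {fset nat}}) : Prop :=
  forall c : seq nat, (2 < size c)%N -> ~ ucycle (adj F) c.

Definition is_tree (C : {fset nat}) (F : {fset {fset nat}}) : Prop :=
  [/\ simple_graph C F,
      forall x y, x \in C -> y \in C -> linked F x y
    & acyclic F].

Definition component (V : {fset nat}) (E : {fset {fset nat}}) (x : nat)
  : {fset nat} := [fset y in V | `[< linked E x y >]].

Definition induced (F : {fset {fset nat}}) (C : {fset nat})
  : {fset {fset nat}} := [fset e in F | e `<=` C].

Definition spanning_forest (V : {fset nat}) (E F : {fset {fset nat}}) : Prop :=
  F `<=` E /\
  forall x, x \in V -> is_tree (component V E x) (induced F (component V E x)).

(** Only the values of [weight] on [edges] matter. *)
Record input (R : realType) := Input {
  vertices : {fset nat};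
  edges : {fset {fset nat}};
  weight : {fset nat} -> R;
  arrival_order : seq {fset nat};
  input_simple : simple_graph vertices edges;
  input_weight_gt0 : forall e, e \in edges -> 0 < weight e;
  input_order : perm_eq arrival_order edges
}.

Definition total_weight (R : realType) (s : input R) (F : {fset {fset nat}})
  : R := \sum_(e <- F) weight s e.

(** The set is finite and nonempty, so this infimum is a minimum. *)
Definition OPT (R : realType) (s : input R) : R :=
  inf [set v : R | exists2 F, spanning_forest (vertices s) (edges s) F
                            & v = total_weight s F]%classic.

Definition history (R : realType) (s : input R) (t : nat)
  : seq ({fset nat} * R) := [seq (e, weight s e) | e <- take t (arrival_order s)].

Definition revealed_edges (R : realType) (s : input R) (t : nat)
  : {fset {fset nat}} := [fset e in take t (arrival_order s)].

Definition revealed_vertices (R : realType) (s : input R) (t : nat)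
  : {fset nat} := \bigcup_(e <- take t (arrival_order s)) e.

Record decision := Decision {
  to_accept : {fset {fset nat}};
  to_reject : {fset {fset nat}}
}.

Record state := State {
  accepted : {fset {fset nat}};
  late_rejected : {fset {fset nat}}
}.

Definition apply_decision (q : state) (d : decision) : state :=
  State ((accepted q `|` to_accept d) `\` to_reject d)
        (late_rejected q `|` to_reject d).

(** The decision at an arrival is a function of the sequence of edges and
    weights seen so far, the newly arrived one being last. *)
Fixpoint state_after (R : realType) (A : seq ({fset nat} * R) -> decision)
    (s : input R) (t : nat) : state :=
  if t is t'.+1 then
    apply_decision (state_after A s t') (A (history s t))
  else State fset0 fset0.

Definition late_accept_reject_legal (R : realType)
    (A : seq ({fset nat} * R) -> decision) (s : input R) : Prop :=
  forall t, (t < size (arrival_order s))%N ->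
    let q := state_after A s t in
    let d := A (history s t.+1) in
    to_accept d `<=` revealed_edges s t.+1 `\` late_rejected q /\
    to_reject d `<=` accepted q `|` to_accept d.

Definition feasible (R : realType)
    (A : seq ({fset nat} * R) -> decision) (s : input R) : Prop :=
  forall t, (t < size (arrival_order s))%N ->
    spanning_forest (revealed_vertices s t.+1) (revealed_edges s t.+1)
      (accepted (state_after A s t.+1)).

Record online_algorithm (R : realType) := OnlineAlgorithm {
  decide : seq ({fset nat} * R) -> decision;
  decide_legal : forall s, late_accept_reject_legal decide s;
  decide_feasible : forall s, feasible decide s
}.

Definition ALG (R : realType) (A : online_algorithm R) (s : input R) : R :=
  total_weight s (accepted (state_after (decide A) s (size (arrival_order s)))).

Definition competitive (R : realType) (c : R) (A : online_algorithm R) : Prop :=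
  exists alpha : R, forall s : input R, ALG A s <= c * OPT s + alpha.

Definition strictly_competitive (R : realType) (c : R)
    (A : online_algorithm R) : Prop :=
  forall s : input R, ALG A s <= c * OPT s.

(* Main.v *)
(** Fix a strict total order on edges refining the order by weight.  The
    algorithm always holds the set of revealed edges whose endpoints are not
    linked by strictly lighter revealed edges.  An edge leaving this set never
    returns, because the lighter edges that link its endpoints stay revealed;
    so it may be late-rejected.  This set links all revealed edges (induction on
    the order) and is acyclic (the heaviest edge of a cycle is not in it).  It
    has minimum weight among all connecting edge sets, acyclic or not: if such a
    set misses an edge [e] of it, some heavier edge can be exchanged for [e].
    For the lower bound, on a graph with a single edge of weight [W] every
    algorithm pays exactly [W], and [W] is arbitrarily large. *)
Require Import Defs.
From mathcomp Require Import all_boot all_order all_algebra finmap.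
From mathcomp Require Import boolp classical_sets reals.

Set Implicit Arguments.
Unset Strict Implicit.
Unset Printing Implicit Defensive.

Import Order.TTheory GRing.Theory Num.Theory.
Local Open Scope fset_scope.
Local Open Scope ring_scope.

Implicit Types (V : {fset nat}) (E F G : {fset {fset nat}}) (x y a b : nat).

(** * Walks in edge sets and the deletion of one edge *)

Lemma fset2_inj {K : choiceType} {x y a b : K} :
  [fset x; y] = [fset a; b] -> (x = a /\ y = b) \/ (x = b /\ y = a).
Proof.
move=> H.
have /fset2P[xa|xb] : x \in [fset a; b] by rewrite -H fset21.
  have /fset2P[bx|by_] : b \in [fset x; y] by rewrite H fset22.
    have /fset2P[] : y \in [fset a; b] by rewrite -H fset22.
      by left; split=> //; congruence.
    by left.
  by left.
have /fset2P[ax|ay] : a \in [fset x; y] by rewrite H fset21.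
  have /fset2P[] : y \in [fset a; b] by rewrite -H fset22.
    by right.
  by right; split=> //; congruence.
by right.
Qed.

Lemma card2_fset2 {K : choiceType} {e : {fset K}} :
  #|` e| = 2%N -> exists x y : K, e = [fset x; y].
Proof.
move=> e2; have /fset0Pn[x xe] : e != fset0 by rewrite -cardfs_gt0 e2.
move: e2; rewrite (cardfsD1 x) xe add1n => -[/eqP/cardfs1P[y ey]].
by exists x, y; rewrite -ey fsetD1K.
Qed.

Lemma adj_sym F x y : adj F x y = adj F y x.
Proof. by rewrite /adj fsetUC. Qed.

Lemma linked_refl F x : linked F x x.
Proof. by exists [::]. Qed.

Lemma linked_adj F x y : adj F x y -> linked F x y.
Proof. by move=> H; exists [:: y]; rewrite //= H. Qed.

Lemma linked_trans F y x z : linked F x y -> linked F y z -> linked F x z.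
Proof.
move=> [p pp <-] [q qq <-]; exists (p ++ q); last by rewrite last_cat.
by rewrite cat_path pp.
Qed.

Lemma linked_bind F G x y :
  (forall a b, adj F a b -> linked G a b) -> linked F x y -> linked G x y.
Proof.
move=> FG [p + <-]; elim: p x => [|z p IH] x /=; first by move=> _; exact: linked_refl.
by move=> /andP[xz zp]; apply: linked_trans (IH _ zp); exact: FG.
Qed.

Lemma linked_sub {F G x y} : F `<=` G -> linked F x y -> linked G x y.
Proof.
by move=> /fsubsetP FG; apply: linked_bind => a b ab; apply/linked_adj/FG.
Qed.

Lemma linked_sym F x y : linked F x y -> linked F y x.
Proof.
move=> [p + <-]; elim: p x => [|z p IH] x /=; first by move=> _; exact: linked_refl.
move=> /andP[xz /IH zp]; apply: linked_trans zp _.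
by apply: linked_adj; rewrite adj_sym.
Qed.

(** A walk through [f] is cut at its uses of [f]. If it finally leaves [f] at the endpoint where it
    first met [f], the part between is dropped and [f] is avoided; otherwise a single traversal of
    [f] suffices. *)
Lemma linked_cut f F x y : linked F x y ->
  linked (F `\ f) x y \/
  exists a b, [/\ f = [fset a; b], linked (F `\ f) x a & linked (F `\ f) b y].
Proof.
move=> [p + <-]; elim: p x => [|z p IH] x /=; first by left; exact: linked_refl.
move=> /andP[xz /IH {}IH].
have [xzf|xzf] := eqVneq [fset x; z] f; last first.
  have {xzf}xz : linked (F `\ f) x z.
    by apply: linked_adj; rewrite /adj in_fsetD1 xzf.
  case: IH => [IH|[a [b [fab za bl]]]]; first by left; exact: linked_trans IH.
  by right; exists a, b; split=> //; exact: linked_trans za.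
case: IH => [IH|[a [b [fab za bl]]]].
  by right; exists x, z; split=> //; exact: linked_refl.
move: xzf; rewrite fab => /fset2_inj[[xa zb]|[xb za']].
  by right; exists a, b; rewrite xa -fab; split=> //; exact: linked_refl.
by left; rewrite xb -fab.
Qed.

(** Delete the edges of [F] outside [G] one by one. If no deletion separated [x] from [y], they
    would be linked in the intersection; [linked_cut] applies to the first edge whose deletion
    separates them. *)
Lemma linked_cut_outside F G x y :
  linked F x y -> ~ linked (F `&` G) x y ->
  exists (f : {fset nat}) a b, [/\ f \in F `\` G, f = [fset a; b],
    linked (F `\ f) x a & linked (F `\ f) b y].
Proof.
move En : #|` F `\` G| => n.
elim: n F En => [|n IH] F Fn xy Nxy.
  case: Nxy; suff -> : F `&` G = F by [].
  by apply/fsetIidPl; rewrite -fsetD_eq0 -cardfs_eq0 Fn.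
have [f Ff] : exists f : {fset nat}, f \in F `\` G.
  by apply/fset0Pn; rewrite -cardfs_eq0 Fn.
have [xy'|[a [b [fab xa by_]]]] := linked_cut f xy; last by exists f, a, b.
have [| |g [a [b [gF gab xa by_]]]] := IH (F `\ f) _ xy'.
- suff -> : (F `\ f) `\` G = (F `\` G) `\ f.
    by move: Fn; rewrite (cardfsD1 f) Ff => -[].
  by apply/fsetP => g; rewrite !inE; case: (g == f); case: (g \in G).
- by move=> H; apply: Nxy; apply: linked_sub H; apply: fsetSI; exact: fsubsetDl.
exists g, a, b; split=> //.
- by move: gF; rewrite !inE => /andP[-> /andP[_ ->]].
- by apply: linked_sub xa; apply: fsetSD; exact: fsubsetDl.
by apply: linked_sub by_; apply: fsetSD; exact: fsubsetDl.
Qed.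

(** * Connecting edge sets and spanning forests *)

Definition connecting E F : Prop :=
  F `<=` E /\ forall x y, adj E x y -> linked F x y.

Lemma spanning_forest_connecting V E F :
  simple_graph V E -> spanning_forest V E F -> connecting E F.
Proof.
move=> simpleE [FE treeF]; split=> // x y xy.
have [_ /fsubsetP sV] := simpleE _ xy.
have xV : x \in V by apply: sV; exact: fset21.
have yV : y \in V by apply: sV; exact: fset22.
have [_ conn _] := treeF _ xV.
have : linked (induced F (component V E x)) x y.
  apply: conn; rewrite !inE /= ?xV ?yV; apply/asboolP.
    exact: linked_refl.
  exact: linked_adj.
by apply: linked_sub; apply/fsubsetP => e; rewrite !inE => /andP[].
Qed.

Lemma connecting_spanning_forest V E F :
  simple_graph V E -> connecting E F -> acyclic F -> spanning_forest V E F.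
Proof.
move=> simpleE [FE conn] acycF; split=> // r rV.
set C := component V E r.
have CP x : reflect (x \in V /\ linked E r x) (x \in C).
  rewrite !inE /=; apply: (iffP andP) => -[xV /asboolP]; by split=> //; apply/asboolP.
have IF : induced F C `<=` F by apply/fsubsetP => e; rewrite !inE => /andP[].
split=> [e|x y /CP[xV rx] /CP[yV ry]|c c2 /andP[cF cu]].
- rewrite !inE /= => /andP[eF eC]; split=> //.
  by have [] := simpleE e (fsubsetP FE _ eF).
- have [p] : linked F x y.
    by apply: linked_bind conn _; apply: linked_trans ry; exact: linked_sym.
  (* A walk in [F] uses edges of [E] only, so it never leaves the component and all its edges are
     induced. *)
  move=> + <-; elim: p x xV rx => [|z p IH] x xV rx /=.
    by move=> _; exact: linked_refl.
  move=> /andP[xz zp]; have xzE := fsubsetP FE _ xz.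
  have [_ /fsubsetP xzV] := simpleE _ xzE.
  have zV : z \in V by apply: xzV; exact: fset22.
  have rz : linked E r z by apply: linked_trans rx _; exact: linked_adj.
  apply: linked_trans (IH _ zV rz zp); apply: linked_adj.
  rewrite /adj !inE /= -/(adj F x z) xz; apply/fsubsetP => u /fset2P[] ->; exact/CP.
- apply: (acycF c c2); rewrite /ucycle cu andbT.
  by apply: sub_cycle cF => a b; exact: (fsubsetP IF).
Qed.

(** * Maxima, sums over edge sets, and the exchange of one edge *)

Lemma seq_max_le {disp : Order.disp_t} {T : orderType disp} {I : eqType}
    (s : seq I) (h : I -> T) : s != [::] ->
  exists2 i, i \in s & forall j, j \in s -> (h j <= h i)%O.
Proof.
elim: s => // i [|j s] IH _; first by exists i; rewrite ?mem_head // => j /[!inE] /eqP->.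
have [//|k ks kmax] := IH; case: (leP (h i) (h k)) => ik.
  exists k => [|l]; first by rewrite in_cons ks orbT.
  rewrite inE => /predU1P[->//|]; exact: kmax.
exists i; rewrite ?mem_head // => l; rewrite inE => /predU1P[->//|/kmax lk].
exact: le_trans lk (ltW ik).
Qed.

Lemma ler_sum_fsubset {S : numDomainType} (h : {fset nat} -> S) F G :
  F `<=` G -> (forall e, e \in G -> 0 <= h e) ->
  \sum_(e <- F) h e <= \sum_(e <- G) h e.
Proof.
move=> FG h0; rewrite [leRHS](big_fsetID _ (mem F)) /=.
have -> : [fset e in G | e \in F] = F.
  by apply/fsetP => e; rewrite !inE /=; apply: andb_idl; exact: (fsubsetP FG).
rewrite lerDl big_seq sumr_ge0 // => e; rewrite !inE /= => /andP[eG _].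
exact: h0.
Qed.

(** Phrased without subtraction, so that it serves both real weights and natural-number ranks. *)
Lemma sum_exchange {S : nmodType} (h : {fset nat} -> S) F (e f : {fset nat}) :
  f \in F -> e \notin F ->
  h f + \sum_(g <- e |` (F `\ f)) h g = h e + \sum_(g <- F) h g.
Proof.
move=> fF eF; rewrite big_fsetU1 /= ?inE ?(negbTE eF) ?andbF //.
by rewrite [in RHS](big_fsetD1 f) //= addrCA.
Qed.

(** Every use of [f] is rerouted from [a] back to [x], across [e], and from [y] to [b]. As
    [connecting] allows cycles, none have to be excluded after the exchange. *)
Lemma connecting_exchange E F (e f : {fset nat}) x y a b : connecting E F -> e \in E ->
  e = [fset x; y] -> f = [fset a; b] ->
  linked (F `\ f) x a -> linked (F `\ f) b y -> connecting E (e |` (F `\ f)).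
Proof.
move=> [FE conn] eE exy fab xa by_; split.
  rewrite fsubUset fsub1set eE; exact: fsubset_trans (fsubsetDl _ _) FE.
have DF : F `\ f `<=` e |` (F `\ f) by exact: fsubsetUr.
have ab : linked (e |` (F `\ f)) a b.
  apply: linked_trans (linked_sym (linked_sub DF xa)) _.
  apply: linked_trans (linked_sym (linked_sub DF by_)).
  by apply: linked_adj; rewrite /adj -exy fset1U1.
move=> u v /conn; apply: linked_bind => {}u {}v uv.
have [uvf|uvf] := eqVneq [fset u; v] f.
  have /fset2_inj[[<- <-]|[<- <-]] := etrans (esym fab) (esym uvf); first exact: ab.
  exact: linked_sym.
by apply: linked_adj; rewrite /adj in_fsetU in_fsetD1 uvf [_ \in F]uv orbT.
Qed.

(** * The greedy edge set of an order given by keys *)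

Section Greedy.
Context {disp : Order.disp_t} {T : orderType disp} (key : {fset nat} -> T).

Definition lighter E e : {fset {fset nat}} := [fset f in E | (key f < key e)%O].

Definition greedy E : {fset {fset nat}} :=
  [fset e in E | `[< forall x y, e = [fset x; y] -> ~ linked (lighter E e) x y >]].

Lemma greedyP E e : reflect
  (e \in E /\ forall x y, e = [fset x; y] -> ~ linked (lighter E e) x y)
  (e \in greedy E).
Proof.
by rewrite !inE /=; apply: (iffP andP) => -[eE /asboolP ?]; split=> //; apply/asboolP.
Qed.

Lemma lighterS E F e : E `<=` F -> lighter E e `<=` lighter F e.
Proof.
move=> /fsubsetP EF; apply/fsubsetP => f; rewrite !inE /= => /andP[/EF -> ->] //.
Qed.

Lemma lighter_trans E e f : (key e < key f)%O -> lighter E e `<=` lighter E f.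
Proof.
move=> ef; apply/fsubsetP => g; rewrite !inE /= => /andP[-> ge] /=; exact: lt_trans ef.
Qed.

Lemma card_lighter E e f : e \in E -> (key e < key f)%O ->
  (#|` lighter E e| < #|` lighter E f|)%N.
Proof.
move=> eE ef; apply: fproper_ltn_card; rewrite fproperE; apply/andP; split.
  exact: lighter_trans.
by apply/fsubsetPn; exists e; rewrite !inE /= eE ?ef // ltxx.
Qed.

Lemma greedy_sub E : greedy E `<=` E.
Proof. by apply/fsubsetP => e /greedyP[]. Qed.

(** Links by lighter edges survive the growth of the graph. Read contrapositively, a revealed edge
    outside the greedy set stays outside forever. *)
Lemma greedy_mono E F e : E `<=` F -> e \in E -> e \in greedy F -> e \in greedy E.
Proof.
move=> EF eE /greedyP[_ H]; apply/greedyP; split=> // x y exy Lxy.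
by apply: (H x y exy); apply: linked_sub Lxy; exact: lighterS.
Qed.

(** Strong induction on the number of edges lighter than [e]: an edge outside the greedy set is
    bypassed by lighter edges, each of which is linked by induction. *)
Lemma greedy_connecting E : connecting E (greedy E).
Proof.
split=> [|x y]; first exact: greedy_sub.
rewrite /adj; move Ee : [fset x; y] => e.
elim: {e}_.+1 {-2}e (ltnSn #|` lighter E e|) x y Ee => // n IH e en x y exy eE.
have [eG|/greedyP NeG] := boolP (e \in greedy E).
  by apply: linked_adj; rewrite /adj exy.
have : linked (lighter E e) x y.
  apply/not_notP => Nxy; apply: NeG; split=> // a b.
  move=> /(etrans exy)/fset2_inj[[<- <-]|[<- <-]] // /linked_sym; exact: Nxy.
apply: linked_bind => a b; rewrite /adj !inE /= => /andP[abE abe].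
apply: (IH [fset a; b]) => //; apply: leq_trans (card_lighter abE abe) _.
by rewrite -ltnS.
Qed.

Hypothesis key_inj : injective key.

(* The endpoints of the heaviest edge of a cycle are linked by the rest of the
   cycle, which consists of lighter edges. *)
Lemma greedy_acyclic E : acyclic (greedy E).
Proof.
move=> c c2 /andP[cG cu].
(* Each edge of the cycle is represented by its first vertex; the cycle is then rotated to start
   with its heaviest edge. *)
have [|x0 x0c x0max] := @seq_max_le _ _ _ c (fun x => key [fset x; next c x]).
  by case: c c2 {cG cu}.
have [i s crot] := rot_to x0c.
have cu' := cu; rewrite -(rot_uniq i) crot in cu'.
have x0max' a : a \in x0 :: s ->
    (key [fset a; next (x0 :: s) a] <= key [fset x0; next (x0 :: s) x0])%O.
  by rewrite -crot mem_rot !next_rot //; exact: x0max.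
move: cG c2; rewrite -(rot_cycle i) -(size_rot i) crot.
case: s crot cu' x0max' => [|y [|z s]] // _ cu' cmax cG _.
set c' := [:: x0, y, z & s] in cu' cmax cG.
(* [r] leaves steps out of [x0] unrestricted, which exempts just the heaviest edge; all other steps
   must use lighter edges. *)
pose r a b := (a == x0) || adj (lighter E [fset x0; y]) a b.
have nx0 : next c' x0 = y by rewrite /= eqxx.
move: (cu'); rewrite /= !inE !negb_or => /and3P[/and3P[x0y x0z x0s] _ _].
have ny : next c' y = z by rewrite /= eq_sym (negbTE x0y) eqxx.
have x0c' : x0 \in c' by exact: mem_head.
have Nx0y : ~ linked (lighter E [fset x0; y]) x0 y.
  by have := next_cycle cG x0c'; rewrite nx0 => /greedyP[_]; exact.
have : cycle r c'.
  clearbody c'; apply: cycle_from_next => // a ac; rewrite /r.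
  have [//|ax0] := eqVneq a x0.
  have := next_cycle cG ac; rewrite /adj => /greedyP[aE _].
  rewrite !inE /= aE lt_neqAle -{2}nx0 cmax // andbT.
  (* A tie would make this edge equal to the heaviest one, traversed backwards from [y] to [x0]; but
     [y] is followed by [z], which differs from [x0] because the cycle has at least three
     vertices. *)
  apply/eqP => /key_inj/fset2_inj[[/eqP]|[ay]]; first by rewrite (negbTE ax0).
  by rewrite ay ny => /esym/eqP; rewrite (negbTE x0z).
have x0q : x0 \notin z :: s by rewrite inE negb_or x0z.
have linked_x0 q a : x0 \notin q -> x0 != a -> path r a (rcons q x0) ->
    linked (lighter E [fset x0; y]) a x0.
  elim: q a => [|t q IH] a /= + x0a; rewrite {1}/r eq_sym (negbTE x0a) /=.
    by rewrite andbT => _ /linked_adj.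
  rewrite inE negb_or => /andP[x0t x0q'] /andP[/linked_adj aL].
  by move=> /(IH _ x0q' x0t); exact: linked_trans.
by rewrite /cycle => /andP[_ /(linked_x0 (z :: s) y x0q x0y)/linked_sym].
Qed.

Context {R : realType} (w : {fset nat} -> R).
Hypothesis w_key : forall e f, (key e <= key f)%O -> w e <= w f.

(** The induction is on the total rank of [F], since an exchange strictly lowers keys but may leave
    the weight unchanged. It ends when [F] contains the greedy set, where positivity of the weights
    concludes. *)
Lemma greedy_min V E F : simple_graph V E -> (forall e, e \in E -> 0 < w e) ->
  connecting E F -> \sum_(e <- greedy E) w e <= \sum_(e <- F) w e.
Proof.
move=> simpleE w0.
pose rank e := #|` lighter E e|.
elim: {F}_.+1 {-2}F (ltnSn (\sum_(e <- F) rank e)%N) => // n IH F Fn connF.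
have [FE conn] := connF.
have [GF|/fsubsetPn[e eG eF]] := boolP (greedy E `<=` F).
  by apply: ler_sum_fsubset GF _ => e /(fsubsetP FE)/w0/ltW.
have [eE Ne] := greedyP _ _ eG.
have [/card2_fset2[x [y exy]] _] := simpleE _ eE.
have xy : linked F x y by apply: conn; rewrite /adj -exy.
(* The endpoints of [e] are linked in [F] but not by lighter edges, so some edge [f] of [F] that is
   not lighter than [e] can be exchanged for [e]. *)
have [|f [a [b [/fsetDP[fF fL] fab xa by_]]]] := linked_cut_outside (G := lighter E e) xy.
  by move=> /(linked_sub (fsubsetIr _ _)); exact: Ne.
have fE := fsubsetP FE _ fF.
have ef : (key e < key f)%O.
  move: fL; rewrite !inE fE /= -leNgt le_eqVlt => /predU1P[/key_inj ef|//].
  by move: eF; rewrite ef fF.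
have := sum_exchange w fF eF; have /= := sum_exchange rank fF eF.
set F' := e |` (F `\ f) => rankE wE.
apply: (@le_trans _ _ (\sum_(g <- F') w g)).
  apply: IH; last exact: connecting_exchange exy fab xa by_.
  have {}rankE : (rank f + \sum_(g <- F') rank g = rank e + \sum_(g <- F) rank g)%N.
    exact: rankE.
  by rewrite -(ltn_add2l (rank f)) rankE -addSn leq_add // card_lighter.
by rewrite -(lerD2l (w f)) wE lerD2r w_key // ltW.
Qed.

End Greedy.

(** Allows weights read off the history, which are correct on revealed edges only, to be replaced by
    the true weights. *)
Lemma eq_in_greedy {disp : Order.disp_t} {T : orderType disp}
    (k l : {fset nat} -> T) E : {in E, k =1 l} -> greedy k E = greedy l E.
Proof.
move=> kl; apply/fsetP => e; rewrite !inE /=.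
have [eE|//] := boolP (e \in E).
have -> // : lighter k E e = lighter l E e.
by apply/fsetP => f; rewrite !inE /=; have [fE|//] := boolP (f \in E); rewrite !kl.
Qed.


(** * The online algorithm and its optimality *)

Section Algorithm.
Context {R : realType}.
Implicit Types (w : {fset nat} -> R) (h : seq ({fset nat} * R)) (s : input R).

(* Ties are broken by the encoding of edges as natural numbers, which does not
   depend on the input. *)
Definition weight_key w e : R *l nat := (w e, choice.pickle e).

Lemma weight_key_inj w : injective (weight_key w).
Proof. by move=> e f [_ /(pcan_inj choice.pickleK)]. Qed.

Lemma weight_key_le w e f : (weight_key w e <= weight_key w f)%O -> w e <= w f.
Proof. by rewrite /weight_key lexi_pair => /andP[]. Qed.

(** For an edge not yet revealed the index is out of range and the value is the default 0. *)
Definition history_weight h e : R := nth 0 (unzip2 h) (index e (unzip1 h)).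

Definition msf h : {fset {fset nat}} :=
  greedy (weight_key (history_weight h)) [fset e in unzip1 h].

(** The previous set is recomputed from the history without its last entry, because a decision sees
    no state. Adding the new set and removing the old edges outside it leaves exactly the new
    set. *)
Definition msf_decide h : decision :=
  Decision (msf h) (msf (take (size h).-1 h) `\` msf h).

Lemma unzip1_history s t : unzip1 (history s t) = take t (arrival_order s).
Proof. by rewrite /unzip1 /history -map_comp map_id. Qed.

Lemma msf_history s t :
  msf (history s t) = greedy (weight_key (weight s)) (revealed_edges s t).
Proof.
rewrite /msf unzip1_history; apply: eq_in_greedy => e; rewrite !inE /= => et.
rewrite /weight_key /history_weight unzip1_history /unzip2 /history -map_comp.
by rewrite (nth_map fset0) ?index_mem //= nth_index.
Qed.

Lemma revealed_edgesS s t : revealed_edges s t `<=` revealed_edges s t.+1.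
Proof.
apply/fsubsetP => e; rewrite !inE /= -(take_takel _ (leqnSn t)); exact: mem_take.
Qed.

Lemma mem_revealed s t e : e \in revealed_edges s t -> e \in edges s.
Proof. by rewrite !inE /= => /mem_take; rewrite (perm_mem (input_order s)). Qed.

Lemma revealed_edges_size s :
  revealed_edges s (size (arrival_order s)) = edges s.
Proof.
by apply/fsetP => e; rewrite !inE /= take_size (perm_mem (input_order s)).
Qed.

Lemma revealed_simple s t : simple_graph (revealed_vertices s t) (revealed_edges s t).
Proof.
move=> e et; split; first by have [] := input_simple (mem_revealed et).
by move: et; rewrite !inE /= => et; exact: bigfcup_sup.
Qed.

Lemma msf_decide_history s t : (t < size (arrival_order s))%N ->
  msf_decide (history s t.+1) =
    Decision (msf (history s t.+1)) (msf (history s t) `\` msf (history s t.+1)).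
Proof.
move=> ts; rewrite /msf_decide; congr (Decision _ (msf _ `\` _)).
by rewrite /history size_map size_takel //= -map_take take_takel.
Qed.

(** The bound on [late_rejected] is the invariant behind legality: by [greedy_mono], revealed edges
    outside the current set are outside the next one too, so no rejected edge is requested again. *)
Lemma msf_state s t : (t <= size (arrival_order s))%N ->
  accepted (state_after msf_decide s t) = msf (history s t) /\
  late_rejected (state_after msf_decide s t)
    `<=` revealed_edges s t `\` msf (history s t).
Proof.
elim: t => [|t IH] ts.
  rewrite /= msf_history fsub0set; split=> //; apply/esym/eqP.
  rewrite -fsubset0; apply: fsubset_trans (greedy_sub _ _) _.
  by rewrite /revealed_edges take0; apply/fsubsetP => e; rewrite !inE.
have [acc rej] := IH (ltnW ts).
rewrite [state_after _ _ _]/= msf_decide_history //= acc; split.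
  by apply/fsetP => e; rewrite in_fsetD in_fsetU in_fsetD; do 2!case: (e \in msf _).
apply/fsubsetP => e /fsetUP[/(fsubsetP rej)/fsetDP[et]|/fsetDP[+ eS]].
  move=> eN; apply/fsetDP; split; first exact: (fsubsetP (revealed_edgesS _ _)).
  apply: contra eN; rewrite !msf_history; apply: greedy_mono et.
  exact: revealed_edgesS.
move=> et; apply/fsetDP; split=> //; apply: (fsubsetP (revealed_edgesS _ _)).
by move: et; rewrite msf_history => /(fsubsetP (greedy_sub _ _)).
Qed.

Lemma msf_legal s : late_accept_reject_legal msf_decide s.
Proof.
move=> t ts q d; have [acc rej] := msf_state (ltnW ts).
rewrite /d msf_decide_history //=; split; last first.
  by rewrite acc; apply: fsubset_trans (fsubsetDl _ _) (fsubsetUl _ _).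
apply/fsubsetP => e em; apply/fsetDP; split.
  by move: em; rewrite msf_history; exact: (fsubsetP (greedy_sub _ _)).
apply/negP => /(fsubsetP rej)/fsetDP[et]; apply/negP/negPn.
move: em; rewrite !msf_history; apply: greedy_mono et; exact: revealed_edgesS.
Qed.

Lemma msf_feasible s : feasible msf_decide s.
Proof.
move=> t ts; have [-> _] := msf_state ts; rewrite msf_history.
apply: connecting_spanning_forest; first exact: revealed_simple.
  exact: greedy_connecting.
by apply: greedy_acyclic; exact: weight_key_inj.
Qed.

Definition msf_algorithm : online_algorithm R :=
  OnlineAlgorithm msf_legal msf_feasible.

Lemma ALG_msf s : ALG msf_algorithm s = OPT s.
Proof.
have [acc _] := msf_state (leqnn (size (arrival_order s))).
rewrite /ALG /= acc msf_history revealed_edges_size.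
set G := greedy _ _.
have GF F : spanning_forest (vertices s) (edges s) F ->
    total_weight s G <= total_weight s F.
  move=> /(spanning_forest_connecting (@input_simple _ s)) connF.
  apply: greedy_min connF; first exact: weight_key_inj.
  - exact: weight_key_le.
  - exact: (@input_simple _ s).
  - exact: input_weight_gt0.
have spG : spanning_forest (vertices s) (edges s) G.
  apply: connecting_spanning_forest; first exact: input_simple.
    exact: greedy_connecting.
  by apply: greedy_acyclic; exact: weight_key_inj.
(* [G] is itself a spanning forest and a lightest one; it supplies both the nonemptiness and the
   lower bound required by the lemmas on [inf]. *)
apply/le_anti/andP; split.
  by apply: lb_le_inf => [|_ [F /GF ? ->] //]; exists (total_weight s G), G.
apply: ge_inf; last by exists G.
by exists (total_weight s G) => _ [F /GF ? ->].
Qed.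

(** * The lower bound from a single edge *)

Lemma single_edge_input (W : R) : 0 < W -> exists s : input R,
  forall A : online_algorithm R, ALG A s = W /\ OPT s = W.
Proof.
move=> W0; pose e : {fset nat} := [fset 0%N; 1%N].
have e2 : #|` e| = 2%N by rewrite cardfs2.
have simple_e : simple_graph e [fset e] by move=> f /fset1P->.
have W0' f : f \in [fset e] -> 0 < W by [].
have order_e : perm_eq [:: e] [fset e].
  by apply: uniq_perm => [||f]; rewrite ?fset_uniq ?inE.
pose s := Input simple_e W0' order_e.
have forest_e F : spanning_forest e [fset e] F -> F = [fset e].
  move=> /(spanning_forest_connecting simple_e)[Fe /(_ 0%N 1%N)].
  (* A walk from 0 to 1 is nonempty, and its first edge lies in [F] and hence is [e]. *)
  rewrite {1}/adj fset11 => -[//|[|y p]] //= /andP[]; rewrite /adj => yF _ _.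
  apply/eqP; rewrite eqEfsubset Fe fsub1set /=.
  by have /fset1P <- := fsubsetP Fe _ yF.
have weight_e F : spanning_forest e [fset e] F -> total_weight s F = W.
  by move=> /forest_e->; rewrite /total_weight big_seq_fset1.
exists s => A.
have forestA : spanning_forest e [fset e] (accepted (state_after (decide A) s 1)).
  have := @decide_feasible _ A s 0 isT.
  (* After the only arrival the revealed graph is the whole input, so feasibility at that moment
     gives a spanning forest of it. *)
  suff [-> ->] : revealed_vertices s 1 = e /\ revealed_edges s 1 = [fset e] by [].
  split; first exact: big_seq1.
  by apply/fsetP => f; rewrite !inE orbF.
split; first exact: weight_e.
rewrite /OPT; suff -> : [set v | exists2 F, spanning_forest e [fset e] F
  & v = total_weight s F]%classic = [set W]%classic by exact: inf1.
apply/seteqP; split=> v /=; first by move=> [F /weight_e wF ->].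
by move->; exists (accepted (state_after (decide A) s 1)); rewrite ?weight_e.
Qed.

End Algorithm.

Theorem theorem17 (R : realType) :
  (exists A : online_algorithm R,
     strictly_competitive 1 A /\ forall s : input R, ALG A s = OPT s) /\
  (forall c : R, c < 1 -> forall A : online_algorithm R, ~ competitive c A).
Proof.
split=> [|c c1 A [alpha comp]].
  exists msf_algorithm; split=> s; last exact: ALG_msf.
  by rewrite ALG_msf mul1r.
have c1' : 0 < 1 - c by rewrite subr_gt0.
(* Chosen so that [W * (1 - c)] is [|alpha| + 1], whereas competitiveness would bound it by
   [alpha]. *)
pose W := (`|alpha| + 1) / (1 - c).
have W0 : 0 < W by rewrite divr_gt0 // ltr_wpDl.
have [s /(_ A)[algW optW]] := single_edge_input W0.
have := comp s; rewrite algW optW -lerBlDl -{1}[W]mul1r -mulrBl mulrC divfK ?gt_eqF //.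
by rewrite leNgt (le_lt_trans (ler_norm alpha)) // ltrDl.
Qed.
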